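(* Let $\mathcal{X}$ be a finite set with $|\mathcal{X}|\geq 2$ and let $\mathcal{T}$ be a Hausdorff natural topology on $\mathrm{DMC}_{\mathcal{X},\ast}^{(o)}$. Then $(\mathrm{DMC}_{\mathcal{X},\ast}^{(o)},\mathcal{T})$ is not a Baire space.
   Context: For finite nonempty sets $\mathcal{X},\mathcal{Y}$, $\mathrm{DMC}_{\mathcal{X},\mathcal{Y}}$ is the set of channels from $\mathcal{X}$ to $\mathcal{Y}$, i.e. functions $W:\mathcal{X}\times\mathcal{Y}\to[0,1]$, written $W(y|x)$, with $\sum_{y\in\mathcal{Y}}W(y|x)=1$ for every $x\in\mathcal{X}$. It carries the topology inherited from the Euclidean topology of $\mathbb{R}^{\mathcal{X}\times\mathcal{Y}}$. For $W\in\mathrm{DMC}_{\mathcal{X},\mathcal{Y}}$ and $V\in\mathrm{DMC}_{\mathcal{Y},\mathcal{Z}}$, the composition $V\circ W\in\mathrm{DMC}_{\mathcal{X},\mathcal{Z}}$ is $(V\circ W)(z|x)=\sum_{y\in\mathcal{Y}}V(z|y)W(y|x)$. A channel $W'\in\mathrm{DMC}_{\mathcal{X},\mathcal{Z}}$ is degraded from $W\in\mathrm{DMC}_{\mathcal{X},\mathcal{Y}}$ if $W'=V\circ W$ for some $V\in\mathrm{DMC}_{\mathcal{Y},\mathcal{Z}}$; $W$ and $W'$ are equivalent if each is degraded from the other. $\mathrm{DMC}_{\mathcal{X},\mathcal{Y}}^{(o)}$ is the quotient of $\mathrm{DMC}_{\mathcal{X},\mathcal{Y}}$ by this equivalence relation,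 with the quotient topology $\mathcal{T}_{\mathcal{X},\mathcal{Y}}^{(o)}$. Let $[n]=\{1,\dots,n\}$, let $\mathrm{DMC}_{\mathcal{X},\ast}=\coprod_{n\ge1}\mathrm{DMC}_{\mathcal{X},[n]}$, and let $\mathrm{DMC}_{\mathcal{X},\ast}^{(o)}$ be the quotient set of $\mathrm{DMC}_{\mathcal{X},\ast}$ by equivalence of channels. For each $n\geq 1$, $\mathrm{DMC}_{\mathcal{X},[n]}^{(o)}$ is identified with the subset of $\mathrm{DMC}_{\mathcal{X},\ast}^{(o)}$ consisting of the classes containing a channel with output alphabet $[n]$; these subsets increase with $n$ and their union is $\mathrm{DMC}_{\mathcal{X},\ast}^{(o)}$. A topology on $\mathrm{DMC}_{\mathcal{X},\ast}^{(o)}$ is called natural if for every $n\ge1$ the subspace topology it induces on $\mathrm{DMC}_{\mathcal{X},[n]}^{(o)}$ is $\mathcal{T}_{\mathcal{X},[n]}^{(o)}$. A Baire space is a topological space in which every countable intersection of dense open subsets is dense. *)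

(* Defs.v *)
From HB Require Import structures.
From mathcomp Require Import all_boot all_order all_algebra generic_quotient.
From mathcomp Require Import all_classical all_reals all_analysis.

Set Implicit Arguments.
Unset Strict Implicit.
Unset Printing Implicit Defensive.

Import Order.TTheory GRing.Theory Num.Theory.
Import numFieldNormedType.Exports.

Local Open Scope classical_set_scope.
Local Open Scope ring_scope.
Local Open Scope quotient_scope.

Section Channels.
Variable R : realType.

Definition channel_set (X Y : finType) : set {ptws X * Y -> R} :=
  [set W | (forall x y, 0 <= W (x, y) <= 1) /\
           (forall x, \sum_(y : Y) W (x, y) = 1)].

(* The topology of [DMC X Y] is induced by the product topology of R^(X * Y). *)
Definition DMC (X Y : finType) : Type := set_type (@channel_set X Y).
HB.instance Definition _ (X Y : finType) :=
  Topological.on (DMC X Y).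

(* [W x y] is the transition probability W(y|x). *)
Definition channel_fun (X Y : finType) (W : DMC X Y) (x : X) (y : Y) : R :=
  (\val W : X * Y -> R) (x, y).
Coercion channel_fun : DMC >-> Funclass.

Lemma channel_ge0 (X Y : finType) (W : DMC X Y) x y : 0 <= W x y.
Proof. by have [/(_ x y)/andP[]] := set_valP W. Qed.

Lemma channel_sum1 (X Y : finType) (W : DMC X Y) x : \sum_(y : Y) W x y = 1.
Proof. by have [_ /(_ x)] := set_valP W. Qed.

Lemma channelP (X Y : finType) (V W : DMC X Y) :
  (forall x y, V x y = W x y) -> V = W.
Proof. by move=> VW; apply/val_inj/funext => -[x y]; exact: VW. Qed.

Lemma channel_comp_subproof (X Y Z : finType) (V : DMC Y Z) (W : DMC X Y) :
  (fun xz => \sum_(y : Y) V y xz.2 * W xz.1 y) \in @channel_set X Z.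
Proof.
have ge0 (x : X) (z : Z) : 0 <= \sum_(y : Y) V y z * W x y.
  by apply: sumr_ge0 => y _; rewrite mulr_ge0// channel_ge0.
have sum1 (x : X) : \sum_(z : Z) \sum_(y : Y) V y z * W x y = 1.
  rewrite exchange_big/= -[RHS](channel_sum1 W x); apply: eq_bigr => y _.
  by rewrite -mulr_suml channel_sum1 mul1r.
rewrite inE; split=> [x z|x] //=; rewrite ge0/= -(sum1 x) (bigD1 z)//= lerDl.
by apply: sumr_ge0 => ? _; exact: ge0.
Qed.

Definition channel_comp (X Y Z : finType) (V : DMC Y Z) (W : DMC X Y) :
  DMC X Z :=
  exist (fun U => U \in @channel_set X Z) _ (channel_comp_subproof V W).

Definition degraded (X Y Z : finType) (W' : DMC X Z) (W : DMC X Y) : Prop :=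
  exists V : DMC Y Z, W' = channel_comp V W.

Definition channel_equiv (X Y Z : finType) (W : DMC X Y) (W' : DMC X Z) :
  Prop := degraded W' W /\ degraded W W'.

Lemma id_channel_subproof (Y : finType) :
  (fun yz => (yz.1 == yz.2)%:R) \in @channel_set Y Y.
Proof.
rewrite inE; split=> [x y|x] /=; first by case: eqP; rewrite ler01 lexx.
by rewrite (bigD1 x)//= eqxx big1 ?addr0// => y /negPf; rewrite eq_sym => ->.
Qed.

Lemma degraded_refl (X Y : finType) (W : DMC X Y) : degraded W W.
Proof.
exists (exist (fun U => U \in @channel_set Y Y) _ (id_channel_subproof Y)); apply: channelP => x y.
rewrite {2}/channel_fun/= (bigD1 y)//= /channel_fun/= eqxx mul1r.
by rewrite big1 ?addr0// => z /negPf ->; rewrite mul0r.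
Qed.

Lemma degraded_trans (X Y Z T : finType)
  (W1 : DMC X Y) (W2 : DMC X Z) (W3 : DMC X T) :
  degraded W1 W2 -> degraded W2 W3 -> degraded W1 W3.
Proof.
move=> [V ->] [U ->]; exists (channel_comp V U); apply: channelP => x y.
rewrite {1}/channel_fun [RHS]/channel_fun/=.
under eq_bigr do rewrite {2}/channel_fun/= mulr_sumr.
rewrite exchange_big/=; apply: eq_bigr => z _.
rewrite {3}/channel_fun/= mulr_suml; apply: eq_bigr => t _.
by rewrite mulrA.
Qed.

Lemma channel_equiv_refl (X Y : finType) (W : DMC X Y) : channel_equiv W W.
Proof. by split; exact: degraded_refl. Qed.

Lemma channel_equiv_sym (X Y Z : finType) (V : DMC X Y) (W : DMC X Z) :
  channel_equiv V W -> channel_equiv W V.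
Proof. by case. Qed.

Lemma channel_equiv_trans (X Y Z T : finType)
  (W1 : DMC X Y) (W2 : DMC X Z) (W3 : DMC X T) :
  channel_equiv W1 W2 -> channel_equiv W2 W3 -> channel_equiv W1 W3.
Proof.
move=> [W21 W12] [W32 W23].
by split; [exact: degraded_trans W32 W21|exact: degraded_trans W12 W23].
Qed.

Section FixedOutput.
Variables X Y : finType.

Definition DMC_rel : rel (DMC X Y) := fun V W => `[< channel_equiv V W >].

Lemma DMC_rel_refl : reflexive DMC_rel.
Proof. by move=> W; apply/asboolP; exact: channel_equiv_refl. Qed.

Lemma DMC_rel_sym : symmetric DMC_rel.
Proof.
by move=> V W; apply: asbool_equiv_eq; split; exact: channel_equiv_sym.
Qed.

Lemma DMC_rel_trans : transitive DMC_rel.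
Proof.
move=> W2 W1 W3 /asboolP W12 /asboolP W23; apply/asboolP.
exact: channel_equiv_trans W12 W23.
Qed.

Canonical DMC_equiv := EquivRel DMC_rel DMC_rel_refl DMC_rel_sym DMC_rel_trans.

Definition DMCo : Type := quotient_topology {eq_quot DMC_equiv}.
HB.instance Definition _ := Topological.on DMCo.
HB.instance Definition _ := Quotient.on DMCo.

End FixedOutput.

Section AllOutputs.
Variable X : finType.

(* ['I_n.+1] plays the role of the alphabet [n+1], so that n ranges over the
   nonempty alphabets. *)
Definition DMC_all : Type := {n : nat & DMC X 'I_n.+1}.
HB.instance Definition _ := Choice.on DMC_all.

Definition DMC_all_rel : rel DMC_all :=
  fun V W => `[< channel_equiv (projT2 V) (projT2 W) >].

Lemma DMC_all_rel_refl : reflexive DMC_all_rel.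
Proof. by move=> W; apply/asboolP; exact: channel_equiv_refl. Qed.

Lemma DMC_all_rel_sym : symmetric DMC_all_rel.
Proof.
by move=> V W; apply: asbool_equiv_eq; split; exact: channel_equiv_sym.
Qed.

Lemma DMC_all_rel_trans : transitive DMC_all_rel.
Proof.
move=> W2 W1 W3 /asboolP W12 /asboolP W23; apply/asboolP.
exact: channel_equiv_trans W12 W23.
Qed.

Canonical DMC_all_equiv :=
  EquivRel DMC_all_rel DMC_all_rel_refl DMC_all_rel_sym DMC_all_rel_trans.

(* A bare quotient set: no topology is attached to it. *)
Definition DMCo_all : Type := {eq_quot DMC_all_equiv}.
HB.instance Definition _ := Choice.on DMCo_all.
HB.instance Definition _ := Quotient.on DMCo_all.

Definition DMCo_at (n : nat) : set DMCo_all :=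
  [set c | exists W : DMC X 'I_n.+1, \pi_DMCo_all (existT _ n W) = c].

Lemma DMCo_ident_subproof n (c : DMCo X 'I_n.+1) :
  \pi_DMCo_all (existT _ n (repr c)) \in DMCo_at n.
Proof. by rewrite inE; exists (repr c). Qed.

(* The identification of the quotient of [DMC X 'I_n.+1] with [DMCo_at n]; see
   [DMCo_ident_pi] and [DMCo_ident_bij]. *)
Definition DMCo_ident n (c : DMCo X 'I_n.+1) : set_type (DMCo_at n) :=
  exist (fun d => d \in DMCo_at n) _ (DMCo_ident_subproof c).

Lemma DMCo_ident_pi n (W : DMC X 'I_n.+1) :
  \val (DMCo_ident (\pi_(DMCo X 'I_n.+1) W)) = \pi_DMCo_all (existT _ n W).
Proof.
apply/eqmodP; rewrite -[is_true _]/(is_true (DMC_equiv X 'I_n.+1 _ W)).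
by apply/eqmodP; rewrite reprK.
Qed.

Lemma DMCo_ident_bij n : bijective (@DMCo_ident n).
Proof.
rewrite -setTT_bijective; split=> [//|c d _ _|c _].
  rewrite -[c]reprK -[d]reprK => /(congr1 \val); rewrite !DMCo_ident_pi.
  by move=> /eqmodP cd; apply/(@eqmodP _ (DMC_equiv X 'I_n.+1)).
have [W Wc] := set_valP c; exists (\pi_(DMCo X 'I_n.+1) W) => //.
by apply: val_inj; rewrite DMCo_ident_pi.
Qed.

(* [Topological DMCo_all] is the type of topologies on [DMCo_all], and
   [set_type] carries the subspace topology. *)
Definition natural_topology (T : Topological DMCo_all) : Prop :=
  forall n (B : set (set_type (DMCo_at n))),
    @open (set_type (DMCo_at n : set (Topological.Pack T))) B <->
    open (@DMCo_ident n @^-1` B).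

End AllOutputs.
End Channels.

Definition baire_space (T : topologicalType) : Prop :=
  forall F : nat -> set T,
    (forall n, open (F n) /\ dense (F n)) -> dense (\bigcap_n F n).

(* Main.v *)
(* Each [DMCo_at n] is a continuous image of the compact space of channels with
   n + 1 outputs, hence closed in the Hausdorff topology T, and these countably
   many sets cover the space; it remains to see that they have empty interior.
   A nonempty open set contained in [DMCo_at n] would pull back to a nonempty
   open set of channels with n + 2 outputs. By a polynomial perturbation it
   contains a channel W whose columns are pairwise non-proportional. If W were
   equivalent to W' with n + 1 outputs, say W' = U o W and W = V o W', then
   A = V o U would fix W. For two inputs x0, x1, put s(y) = W(y|x0) + W(y|x1) and
   t(y) = W(y|x0) / s(y), which is injective in y; invariance of W under A yields
   sum A(z|y) s(y) (t(y) - t(z))^2 = 0, so A is diagonal, which is impossible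
   since U and V factor A through a smaller alphabet. *)
Require Import Defs.
From mathcomp Require Import all_boot all_order all_algebra.
From mathcomp Require Import all_classical all_reals all_analysis.
From mathcomp Require Import generic_quotient ring lra.

Set Implicit Arguments.
Unset Strict Implicit.
Unset Printing Implicit Defensive.

Import Order.TTheory GRing.Theory Num.Theory.
Import numFieldNormedType.Exports.

Local Open Scope classical_set_scope.
Local Open Scope ring_scope.
Local Open Scope quotient_scope.

(** * Stochastic matrices with an invariant weight *)

(** Strict convexity of the square: an invariant weight [s] leaves no room for [t] to vary along a
    transition of positive probability. *)
Lemma stochastic_fixed_ratio (R : realDomainType) (Y : finType)
    (A : Y -> Y -> R) (s t : Y -> R) :
  (forall y z, 0 <= A y z) -> (forall y, 0 < s y) ->
  (forall y, \sum_z A y z = 1) ->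
  (forall z, s z = \sum_y A y z * s y) ->
  (forall z, t z * s z = \sum_y A y z * (t y * s y)) ->
  forall y z, 0 < A y z -> t y = t z.
Proof.
move=> A0 s0 A1 sA tA.
have pos y z : 0 <= A y z * s y * (t y - t z) ^+ 2.
  by rewrite mulr_ge0 ?sqr_ge0// mulr_ge0// ltW.
(* By invariance, expanding the square gives the [s]-weighted second moment of
   [t] minus itself. *)
have sum0 : \sum_z \sum_y A y z * s y * (t y - t z) ^+ 2 = 0.
  transitivity (\sum_z ((\sum_y A y z * (s y * t y ^+ 2)) - s z * t z ^+ 2)).
    apply: eq_bigr => z _.
    transitivity (\sum_y A y z * (s y * t y ^+ 2)
      + (- (t z *+ 2)) * (\sum_y A y z * (t y * s y))
      + t z ^+ 2 * (\sum_y A y z * s y)).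
      rewrite !mulr_sumr -!big_split; apply: eq_bigr => y _ /=; ring.
    by rewrite -sA -tA; ring.
  rewrite sumrB exchange_big /=.
  under eq_bigr do rewrite -mulr_suml A1 mul1r.
  by rewrite subrr.
move=> y z Ayz; move/eqP: sum0.
rewrite psumr_eq0; last by move=> u _; apply: sumr_ge0.
move=> /allP/(_ z); rewrite mem_index_enum => /(_ isT) /=.
rewrite psumr_eq0// => /allP/(_ y); rewrite mem_index_enum => /(_ isT) /=.
rewrite mulf_eq0 sqrf_eq0 subr_eq0 => /orP[|/eqP //].
by rewrite gt_eqF// mulr_gt0.
Qed.

Section Channels.
Variable R : realType.

Lemma channel_set_intro (X Y : finType) (w : X * Y -> R) :
  (forall x y, 0 <= w (x, y)) -> (forall x, \sum_y w (x, y) = 1) ->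
  w \in @channel_set R X Y.
Proof.
move=> ge0 sum1; rewrite inE; split=> [x y|//].
rewrite ge0/= -(sum1 x) (bigD1 y)//= lerDl.
by apply: sumr_ge0 => ? _; exact: ge0.
Qed.

Lemma channel_pos_ex (X Y : finType) (W : DMC R X Y) x : exists y, 0 < W x y.
Proof.
apply: contrapT => /forallNP W0.
have /eqP := channel_sum1 W x; rewrite big1 ?(eq_sym 0) ?oner_eq0// => y _.
by apply/eqP; move/negP: (W0 y); rewrite lt0r channel_ge0 andbT negbK.
Qed.

Lemma channel_compE (X Y Z : finType) (V : DMC R Y Z) (W : DMC R X Y) x z :
  channel_comp V W x z = \sum_(y : Y) V y z * W x y.
Proof. by []. Qed.

(* With [x0], [x1] among the inputs and positive transition probabilities from
   [x0], this says that the columns of [W] are pairwise non-proportional. *)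
Definition generic_channel (X Y : finType) (x0 x1 : X) (W : DMC R X Y) :=
  (forall y, 0 < W x0 y) /\
  (forall y z, W x0 y * W x1 z = W x0 z * W x1 y -> y = z).

Lemma generic_channel_card (X Y Z : finType) (x0 x1 : X)
    (W : DMC R X Y) (W' : DMC R X Z) :
  generic_channel x0 x1 W -> channel_equiv W W' -> (#|Y| <= #|Z|)%N.
Proof.
move=> [W0 Winj] [[U W'E] [V WE]].
pose A := channel_comp V U.
have WA x z : W x z = \sum_y A y z * W x y.
  rewrite {1}WE W'E channel_compE.
  under eq_bigr do rewrite channel_compE mulr_sumr.
  rewrite exchange_big /=; apply: eq_bigr => y _.
  by rewrite channel_compE mulr_suml; apply: eq_bigr => t _; rewrite mulrA.
pose s y := W x0 y + W x1 y; pose t y := W x0 y / s y.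
have s0 y : 0 < s y by rewrite ltr_wpDr// channel_ge0.
have ts y : t y * s y = W x0 y by rewrite divfK// gt_eqF.
have Adiag y z : 0 < A y z -> y = z.
  move=> Ayz; have tyz : t y = t z.
    apply: (@stochastic_fixed_ratio R Y A s t) Ayz => //.
    - by move=> *; exact: channel_ge0.
    - exact: channel_sum1.
    - move=> u; rewrite /s !WA -big_split /=; apply: eq_bigr => v _.
      by rewrite mulrDr.
    - by move=> u; under eq_bigr do rewrite ts; rewrite ts WA.
  apply: Winj.
  (* Once the common term [W x0 y * W x0 z] is cancelled, equality of the ratios is proportionality
     of the columns. *)
  have : W x0 y * s z = W x0 z * s y by rewrite -(ts y) -(ts z) tyz; ring.
  by rewrite /s !mulrDr mulrC => /addrI.
have /choice [f Uf] : forall y, exists z, 0 < U y z.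
  exact: channel_pos_ex.
suff /leq_card : injective f by [].
(* A letter [z] reachable from [f y] is reachable under [A] from both [y] and [y'], so diagonality
   gives [y = z = y']. *)
move=> y y' fyy'; have [z Vz] := channel_pos_ex V (f y).
have AU u : f u = f y -> 0 < A u z.
  move=> fu; rewrite /A channel_compE (bigD1 (f y))//= ltr_wpDr//.
    by apply: sumr_ge0 => v _; rewrite mulr_ge0// channel_ge0.
  by rewrite mulr_gt0// -fu.
by rewrite (Adiag _ _ (AU y erefl)) (Adiag _ _ (AU y' (esym fyy'))).
Qed.

(** * Density of generic channels *)

Lemma nonroot_near0 (p : {poly R}) (d : R) :
  p != 0 -> 0 < d -> exists2 e, 0 < e < d & ~~ root p e.
Proof.
(* These are [size p] distinct points, too many to be all roots; the shift by 2 keeps them strictly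
   below [d]. *)
move=> p0 d0; pose rs := [seq d / k.+2%:R | k <- iota 0 (size p)].
have : ~~ all (root p) rs.
  apply/negP => /(max_poly_roots p0); rewrite size_map size_iota ltnn => H.
  suff /H : uniq rs by [].
  rewrite map_inj_uniq ?iota_uniq// => i j /(mulfI (lt0r_neq0 d0)).
  by move=> /invr_inj/eqP; rewrite eqr_nat => /eqP[].
case/allPn => e /mapP[k _ ->] nr; exists (d / k.+2%:R) => //.
by rewrite divr_gt0//= ltr_pdivrMr// ltr_pMr// ltr1n.
Qed.

Lemma ptws_cvg (I : eqType) (T : topologicalType) (S : Type)
    (F : set_system S) (g : S -> {ptws I -> T}) (f : {ptws I -> T}) :
  Filter F -> (forall i, (fun u => g u i) @ F --> f i) -> g @ F --> f.
Proof.
move=> FF gf; apply/cvg_sup => i U [V [[A oA <-] Afi] AU].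
have : nbhs (f i) A by exact: open_nbhs_nbhs.
move=> /gf; rewrite /= !nbhs_filterE /fmap /=.
by apply: filterS => u; exact: AU.
Qed.

Lemma channel_perturb (X Y : finType) (W P : DMC R X Y) (O : set (DMC R X Y)) :
  open O -> O W -> exists2 d, 0 < d & forall e, 0 < e < d ->
    exists2 V, O V & forall x y, V x y = W x y + e * (P x y - W x y).
Proof.
move=> [A oA AO] OW.
pose g (e : R) : {ptws X * Y -> R} := fun xy =>
  W xy.1 xy.2 + e * (P xy.1 xy.2 - W xy.1 xy.2).
have gW : g 0 = \val W.
  by apply/funext => -[x y]; rewrite /g mul0r addr0.
have gc : g e @[e --> (0:R)] --> (g 0 : {ptws X * Y -> R}).
  apply: ptws_cvg => xy; rewrite /g.
  by apply: cvgD; [exact: cvg_cst|apply: cvgM; [exact: cvg_id|exact: cvg_cst]].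
have : nbhs (g 0) A.
  by apply: open_nbhs_nbhs; split=> //; rewrite gW; move: OW; rewrite -AO.
move=> /gc /nbhs_ballP[d /= d0 dA].
(* The cap at 1 makes [g e] a convex combination of [W] and [P], hence a channel. *)
exists (Num.min d 1); first by rewrite lt_min d0 ltr01.
move=> e /andP[e0]; rewrite lt_min => /andP[ed e1].
have gch : g e \in @channel_set R X Y.
  have ge0 x y : 0 <= g e (x, y).
    rewrite /g /=; have := channel_ge0 W x y; have := channel_ge0 P x y.
    by move: e0 e1; nra.
  have sum1 x : \sum_y g e (x, y) = 1.
    rewrite /g /= big_split /= -mulr_sumr sumrB !channel_sum1.
    by rewrite subrr mulr0 addr0.
  exact: channel_set_intro.
exists (exist (fun U => U \in @channel_set R X Y) _ gch) => //.
rewrite -AO; apply: dA; rewrite /ball /=.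
by rewrite sub0r normrN gtr0_norm.
Qed.

Lemma generic_channel_ex (X : finType) n (x0 x1 : X) : x0 != x1 ->
  exists P : DMC R X 'I_n.+1, generic_channel x0 x1 P.
Proof.
move=> x01; pose S : R := \sum_(y < n.+1) y.+1%:R.
have S0 : 0 < S.
  by rewrite /S big_ord_recl ltr_pwDl// sumr_ge0.
(* Row [x1] is proportional to 1, ..., n+1 and the other rows are uniform, so the column ratios
   differ. *)
pose p (xy : X * 'I_n.+1) : R :=
  if xy.1 == x1 then xy.2.+1%:R / S else n.+1%:R^-1.
have pch : p \in @channel_set R X 'I_n.+1.
  have ge0 x y : 0 <= p (x, y).
    by rewrite /p; case: ifP => _; rewrite ?invr_ge0// divr_ge0// ltW.
  have sum1 x : \sum_y p (x, y) = 1.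
    rewrite /p /=; case: (x == x1).
      by rewrite -[RHS](mulfV (lt0r_neq0 S0)) mulr_suml.
    by rewrite sumr_const card_ord -[LHS]mulr_natr mulVf.
  exact: channel_set_intro.
exists (exist (fun U => U \in @channel_set R X 'I_n.+1) _ pch).
split=> [y|y z]; rewrite /channel_fun /= /p /= (negbTE x01) ?eqxx ?invr_gt0//.
have Sn0 : S^-1 != 0 by rewrite invr_eq0 gt_eqF.
have n0 : n.+1%:R^-1 != 0 :> R by rewrite invr_eq0 pnatr_eq0.
move=> /(mulfI n0) /(mulIf Sn0) /eqP; rewrite eqr_nat eqSS => /eqP zy.
exact/val_inj.
Qed.

Lemma generic_channel_dense (X : finType) n (x0 x1 : X)
    (O : set (DMC R X 'I_n.+1)) :
  x0 != x1 -> open O -> O !=set0 -> exists2 V, O V & generic_channel x0 x1 V.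
Proof.
move=> x01 oO [W OW]; have [P [P0 Pinj]] := generic_channel_ex n x01.
have [d d0 dO] := channel_perturb P oO OW.
pose q x y : {poly R} := (W x y)%:P + 'X * (P x y - W x y)%:P.
have qE x y e : (q x y).[e] = W x y + e * (P x y - W x y).
  by rewrite /q hornerD hornerM hornerX !hornerC.
(* [D] vanishes at [e] exactly when two columns of the segment at [e], restricted to rows [x0] and
   [x1], have zero determinant. At 1 the segment reaches [P], so [D] is nonzero. *)
pose D : {poly R} := \prod_(yz : 'I_n.+1 * 'I_n.+1 | yz.1 != yz.2)
  (q x0 yz.1 * q x1 yz.2 - q x0 yz.2 * q x1 yz.1).
have D0 : D != 0.
  apply: contraTneq isT => D0; have : D.[1] = 0 by rewrite D0 horner0.
  rewrite horner_prod => /eqP/prodf_eq0[[y z] /= yz].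
  rewrite hornerD hornerN !hornerM !qE !mul1r !(addrC (W _ _)) !subrK subr_eq0.
  by move=> /eqP/Pinj/eqP; rewrite (negbTE yz).
have d10 : 0 < Num.min d 1 by rewrite lt_min d0 ltr01.
have [e /andP[e0]] := nonroot_near0 D0 d10.
rewrite lt_min => /andP[ed e1] nD.
have [|V OV VE] := dO e; first by rewrite e0.
exists V => //; split=> [y|y z yz].
  have := channel_ge0 W x0 y; have := P0 y; rewrite VE.
  by move: e0 e1; nra.
apply/eqP; apply: contraNT nD => nyz; rewrite /root horner_prod.
apply/prodf_eq0; exists (y, z) => //=.
by rewrite hornerD hornerN !hornerM !qE -!VE subr_eq0; apply/eqP.
Qed.

(** * Relabelling and padding of the output alphabet *)

Lemma map_channel_subproof (Y Z : finType) (f : Y -> Z) :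
  (fun yz => (f yz.1 == yz.2)%:R) \in @channel_set R Y Z.
Proof.
apply: channel_set_intro => [y z|y] /=; first exact: ler0n.
rewrite (bigD1 (f y))//= eqxx big1 ?addr0// => z /negPf.
by rewrite eq_sym => ->.
Qed.

Definition map_channel (Y Z : finType) (f : Y -> Z) : DMC R Y Z :=
  exist (fun U => U \in @channel_set R Y Z) _ (map_channel_subproof f).

Lemma map_channel_compE (X Y Z : finType) (f : Y -> Z) (W : DMC R X Y) x z :
  channel_comp (map_channel f) W x z = \sum_(y | f y == z) W x y.
Proof.
rewrite channel_compE [RHS]big_mkcond /=; apply: eq_bigr => y _.
by rewrite /channel_fun /=; case: eqP; rewrite ?mul1r ?mul0r.
Qed.

Lemma map_channel_equiv (X Y Z : finType) (f : Y -> Z) (g : Z -> Y)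
    (W : DMC R X Y) :
  cancel f g -> channel_equiv W (channel_comp (map_channel f) W).
Proof.
move=> fK; split; first by exists (map_channel f).
exists (map_channel g); apply: channelP => x y.
rewrite map_channel_compE; under eq_bigr do rewrite map_channel_compE.
rewrite (exchange_big_dep predT)//= (bigD1 y)//=.
rewrite [X in _ + X]big1 => [|y' y'y]; last first.
  by rewrite big1// => z /andP[/eqP gz /eqP fy]; rewrite -gz -fy fK eqxx in y'y.
rewrite addr0 (big_pred1 (f y))// => z /=.
by case: (eqVneq (f y) z) => [<-|]; rewrite ?fK ?eqxx ?andbT ?andbF.
Qed.

Lemma DMCo_atS (X : finType) n : @DMCo_at R X n `<=` @DMCo_at R X n.+1.
Proof.
move=> _ [W <-]; pose f := widen_ord (leqnSn n.+1).
exists (channel_comp (map_channel f) W); apply/eqmodP/asboolP => /=.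
(* [inord] inverts the widening on its image and sends the extra letter to a default. *)
apply: channel_equiv_sym; apply: (@map_channel_equiv _ _ _ f inord).
by move=> i; apply: val_inj; rewrite /= inordK.
Qed.

(** * Compactness of the space of channels *)

Lemma compact_set_type (T : topologicalType) (A : set T) :
  compact A -> compact [set: set_type A].
Proof.
move=> cA F FF _.
have [] := cA (\val @ F).
  by apply: (@filterE _ F) => u; exact: set_valP.
move=> p [Ap clp]; exists (exist (fun u => u \in A) p (mem_set Ap)).
split=> //.
move=> B C FB [_ [[D oD <-] /= Dp] DC].
have FD : F (\val @^-1` (\val @` B)).
  by apply: filterS FB => u Bu; exists u.
have [_ [[u Bu <-] Du]] := clp _ _ FD (open_nbhs_nbhs (conj oD Dp)).
by exists u; split=> //; exact: DC.
Qed.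

Lemma ptws_sum_continuous (I J : finType) (f : J -> I) :
  continuous (fun W : {ptws I -> R} => \sum_j W (f j)).
Proof.
move=> W; pose g j (V : {ptws I -> R}) : R := V (f j).
have gc j : g j @ nbhs W --> g j W by exact: (@proj_continuous _ (fun=> R)).
have := cvg_big (@add_continuous R) (nbhs_filter W)
  (fun j (_ : xpredT j) => gc j).
by apply.
Qed.

Lemma DMC_compact (X Y : finType) : compact [set: DMC R X Y].
Proof.
apply: compact_set_type.
(* Channels form a closed subset of a cube, which is compact by Tychonoff. *)
rewrite (_ : channel_set (Y:=Y) =
  [set W : {ptws X * Y -> R} | forall xy, `[0, 1]%classic (W xy)] `&`
  \bigcap_(x : X)
    ((fun W : {ptws X * Y -> R} => \sum_(y : Y) W (x, y)) @^-1` [set 1])).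
  apply: compact_closedI.
    exact: (tychonoff (fun _ => @segment_compact R 0 1)).
  apply: closed_bigI => x _; apply: preimage_closed; last exact: closed_eq.
  by move=> W _; exact: (@ptws_sum_continuous _ _ (fun y => (x, y))).
apply/seteqP; split=> W /=.
  move=> [W01 W1]; split=> [[x y]|x _]; last exact: W1.
  by rewrite in_itv; exact: W01.
move=> [W01 W1]; split=> [x y|x]; last exact: W1.
by have := W01 (x, y); rewrite in_itv.
Qed.

(** * Consequences of naturality *)

Section Natural.
Variables (X : finType) (T : Topological (DMCo_all R X)).
Hypothesis hT : natural_topology T.

Let class_of n (W : DMC R X 'I_n.+1) : Topological.Pack T :=
  \pi_(DMCo_all R X) (existT _ n W).

(** Naturality makes the trace of an open set open in the quotient, and the projection pulls it back
    to an open set of channels. *)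
Lemma channel_class_continuous n : continuous (@class_of n).
Proof.
apply/continuousP => A oA.
have /hT : @open (set_type (DMCo_at n : set (Topological.Pack T)))
  (\val @^-1` A) by exists A.
move/continuousP: (@pi_continuous _ {eq_quot DMC_equiv R X 'I_n.+1}).
move=> /[apply].
by congr open; apply/funext => W /=; congr A; exact: DMCo_ident_pi.
Qed.

Lemma DMCo_at_closed n : hausdorff_space (Topological.Pack T) ->
  closed (DMCo_at n : set (Topological.Pack T)).
Proof.
move=> hT2; apply: (compact_closed hT2).
have -> : DMCo_at n = @class_of n @` setT.
  by apply/seteqP; split=> [_ [W <-]|_ [W _ <-]]; exists W.
apply: continuous_compact; last exact: DMC_compact.
by apply: continuous_subspaceT; exact: channel_class_continuous.
Qed.

Lemma DMCo_at_codense n : (2 <= #|X|)%N ->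
  dense (~` DMCo_at n : set (Topological.Pack T)).
Proof.
move=> /card_gt1P[x0 [x1 [_ _ x01]]] O [c Oc] oO; apply/set0P/eqP => OD0.
have {OD0} OD : O `<=` DMCo_at n by apply/subsets_disjoint.
have oO' : open (@class_of n.+1 @^-1` O).
  by move/continuousP: (@channel_class_continuous n.+1); exact.
have [|V OV Vgen] := generic_channel_dense x01 oO'.
  (* The pullback is nonempty because a class with n+1 outputs also has a representative with
     n+2. *)
  by have [W Wc] := DMCo_atS (OD _ Oc); exists W; rewrite /= /class_of Wc.
have [W /eqmodP/asboolP /= WV] := OD _ OV.
have := generic_channel_card Vgen (channel_equiv_sym WV).
by rewrite !card_ord ltnn.
Qed.

End Natural.
End Channels.

Theorem proposition7 (R : realType) (X : finType) (hX : (2 <= #|X|)%N)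
    (T : Topological (DMCo_all R X))
    (hT : natural_topology T)
    (hT2 : hausdorff_space (Topological.Pack T)) :
  ~ baire_space (Topological.Pack T).
Proof.
move=> baireT.
have : dense (\bigcap_n ~` DMCo_at n : set (Topological.Pack T)).
  apply: baireT => n; split; last exact: DMCo_at_codense.
  by apply: closed_openC; exact: DMCo_at_closed.
(* Density is tested on the whole space, whose nonemptiness is witnessed by the one-output
   channel. *)
pose c0 := \pi_(DMCo_all R X) (existT _ 0%N (map_channel R (fun=> ord0))).
move=> /(_ setT (ex_intro _ c0 I) openT) [c [_ cD]].
case: (repr c) (reprK c) => n W Wc.
by apply: (cD n I); exists W.
Qed.
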